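(* Let $(\mathcal H,\theta)$ be as in the context, let $(B,\leq,\Psi)$ be a unitriangular basic set for $(\mathcal H,\theta)$, and let $\phi$ be an algebra automorphism of $\mathcal H$ with $\phi^2=\mathrm{Id}_{\mathcal H}$. Let $\preceq$ and $\Theta:B\to\Lambda$ be the total order and the (injective) map defined in the context. Set $\widetilde B:=\Theta(B)$ and define $\widetilde\Psi:\widetilde B\to\operatorname{Irr}(L\mathcal H)$ by $\widetilde\Psi(\lambda)=\Psi(\Theta^{-1}(\lambda))$ for all $\lambda\in\widetilde B$. Then $(\widetilde B,\preceq,\widetilde\Psi)$ is a unitriangular basic set for $(\mathcal H,\theta)$.
   Context: Setting. $A$ is an integral domain, integrally closed in its field of fractions $K$; $\mathcal H$ is an associative symmetric $A$-algebra, finitely generated and free over $A$; $\theta:A\to L$ is a ring homomorphism to a field $L$ which is the field of fractions of $\theta(A)$; $K\mathcal H=K\otimes_A\mathcal H$ is split semisimple and $L\mathcal H=L\otimes_A\mathcal H$ ($L$ an $A$-module via $\theta$) is split. Write $\operatorname{Irr}(K\mathcal H)=\{V^\lambda\mid\lambda\in\Lambda\}$ (with the $V^\lambda$ pairwise non-isomorphic), and $\operatorname{Irr}(L\mathcal H)$ for the set of isomorphism classes of simple $L\mathcal H$-modules. The decomposition map $d_\theta:R_0(K\mathcal H)\to R_0(L\mathcal H)$ between Grothendieck groups of finite-dimensional modules is the additive map such that for each finite-dimensional $K\mathcal H$-module $V$ and each $h\in\mathcal H$, the characteristic polynomial of $h$ on $d_\theta([V])$ is obtained by applying $\theta$ to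 the coefficients of that of $h$ on $V$. The decomposition numbers $d_{\lambda,M}\in\mathbb Z_{\ge0}$ are given by $d_\theta([V^\lambda])=\sum_{M\in\operatorname{Irr}(L\mathcal H)}d_{\lambda,M}[M]$. A unitriangular basic set for $(\mathcal H,\theta)$ is a triple $(B,\leq,\Psi)$ where $B\subset\Lambda$, $\leq$ is a total order on $\Lambda$ and $\Psi:B\to\operatorname{Irr}(L\mathcal H)$ is a bijection such that (1) $d_{\lambda,\Psi(\lambda)}=1$ for all $\lambda\in B$; (2) for all $M\in\operatorname{Irr}(L\mathcal H)$, $\lambda\in\Lambda$, $d_{\lambda,M}=0$ unless $\lambda\leq\Psi^{-1}(M)$. For a module $N$, $N^\phi$ is its twist by $\phi$ (same space, $h$ acts as $\phi(h)$). For $\lambda\in\Lambda$, $\lambda'\in\Lambda$ is defined by $(V^\lambda)^\phi\simeq V^{\lambda'}$; for $\lambda\in B$, $m(\lambda)\in B$ is defined by $\Psi(\lambda)^\phi\simeq\Psi(m(\lambda))$. The total order $\preceq$ on $\Lambda$: $\lambda\preceq\mu$ if and only if $\lambda=\mu$, or ($\lambda=\mu'$ and $\mu'\leq\mu$), or $\operatorname{Max}_\leq(\lambda,\lambda')<\operatorname{Max}_\leq(\mu,\mu')$. The map $\Theta:B\to\Lambda$ is $\Theta(\lambda)=\operatorname{Max}_\preceq\{\lambda,m(\lambda)'\}$; equivalently, $\Theta(\lambda)=\lambda$ if $m(\lambda)\leq\lambda$ and $\Theta(\lambda)=m(\lambda)'$ if $m(\lambda)>\lambda$. $\Theta$ is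 injective. *)

(* Defs.v *)
From HB Require Import structures.
From mathcomp Require Import all_boot all_order all_algebra.
From mathcomp Require Import boolp.
From mathcomp.multinomials Require Import freeg.

Set Implicit Arguments.
Unset Strict Implicit.
Unset Printing Implicit Defensive.

Import GRing.Theory VectorInternalTheory.

Local Open Scope ring_scope.

(* Associative unital algebras that are free of finite rank over R: the        *)
(* Vector structure of H is an R-linear isomorphism v2r : H -> 'rV_(dim H).    *)
#[short(type="freeAlgType")]
HB.structure Definition FreeAlg (R : nzRingType) :=
  {H of Vector R H & GRing.Algebra R H}.

Definition fbasis (A : nzRingType) (H : freeAlgType A) (i : 'I_(dim H)) : H :=
  r2v (delta_mx 0 i).

Definition symmetric_algebra (A : comUnitRingType) (H : freeAlgType A) : Prop :=
  exists tau : {scalar H},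
    (forall x y, tau (x * y) = tau (y * x)) /\
    (\matrix_(i, j) tau (fbasis i * fbasis j) : 'M[A]_(dim H)) \in unitmx.

Definition integrally_closed (A : idomainType) : Prop :=
  forall x : {fraction A},
    integralOver (@FracField.tofrac A) x -> exists a : A, x = FracField.tofrac a.

Definition field_of_fractions_of_image
    (A : nzRingType) (F : fieldType) (f : {rmorphism A -> F}) : Prop :=
  forall x : F, exists a b : A, f b != 0 /\ x = f a / f b.

(* F (x)_A H, where F is an A-algebra through f, in coordinates: row vectors   *)
(* over F, multiplied with the images under f of the structure constants of H  *)
(* in its basis; ext_in f H is the canonical map h |-> 1 (x) h.                *)
Definition scalar_ext (A : comNzRingType) (F : fieldType)
    (f : {rmorphism A -> F}) (H : freeAlgType A) : Type := 'rV[F]_(dim H).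

Section ScalarExtension.
Variables (A : comNzRingType) (F : fieldType) (f : {rmorphism A -> F}).
Variable H : freeAlgType A.

Local Notation FH := (scalar_ext f H).
Local Notation e := (@fbasis A H).

HB.instance Definition _ := GRing.Lmodule.on FH.

Definition ext_in (h : H) : FH := map_mx f (v2r h).

Definition ext_one : FH := ext_in 1.

Definition ext_mul (u v : FH) : FH :=
  \sum_i \sum_j (u 0 i * v 0 j) *: ext_in (e i * e j).

Lemma ext_in_is_zmod_morphism : zmod_morphism ext_in.
Proof. by move=> x y; rewrite /ext_in linearB map_mxB. Qed.

HB.instance Definition _ :=
  GRing.isZmodMorphism.Build H FH ext_in ext_in_is_zmod_morphism.

Lemma ext_inZ a h : ext_in (a *: h) = f a *: ext_in h.
Proof. by rewrite /ext_in linearZ map_mxZ. Qed.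

Lemma fbasis_sum (h : H) : h = \sum_i (v2r h) 0 i *: e i.
Proof.
rewrite -{1}(v2rK h) {1}(row_sum_delta (v2r h)) linear_sum.
by apply: eq_bigr => i _; rewrite linearZ.
Qed.

Lemma ext_in_sum (h : H) : ext_in h = \sum_i f ((v2r h) 0 i) *: ext_in (e i).
Proof.
rewrite {1}(fbasis_sum h) raddf_sum.
by apply: eq_bigr => i _ /=; rewrite ext_inZ.
Qed.

Lemma ext_in_basis i : ext_in (e i) = delta_mx 0 i.
Proof. by rewrite /ext_in /fbasis r2vK map_delta_mx. Qed.

Lemma ext_sum (u : FH) : u = \sum_i u 0 i *: ext_in (e i).
Proof.
by rewrite {1}(row_sum_delta u); apply: eq_bigr => i _; rewrite ext_in_basis.
Qed.

Lemma ext_mulDl : left_distributive ext_mul +%R.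
Proof.
move=> u v w; rewrite /ext_mul -big_split /=; apply: eq_bigr => i _.
rewrite -big_split /=; apply: eq_bigr => j _.
by rewrite mxE mulrDl scalerDl.
Qed.

Lemma ext_mulDr : right_distributive ext_mul +%R.
Proof.
move=> u v w; rewrite /ext_mul -big_split /=; apply: eq_bigr => i _.
rewrite -big_split /=; apply: eq_bigr => j _.
by rewrite mxE mulrDr scalerDl.
Qed.

Lemma ext_mulZl a u v : ext_mul (a *: u) v = a *: ext_mul u v.
Proof.
rewrite /ext_mul scaler_sumr; apply: eq_bigr => i _.
rewrite scaler_sumr; apply: eq_bigr => j _.
by rewrite mxE -mulrA scalerA.
Qed.

Lemma ext_mulZr a u v : ext_mul u (a *: v) = a *: ext_mul u v.
Proof.
rewrite /ext_mul scaler_sumr; apply: eq_bigr => i _.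
rewrite scaler_sumr; apply: eq_bigr => j _.
by rewrite mxE mulrCA scalerA.
Qed.

Lemma ext_mul0l v : ext_mul 0 v = 0.
Proof. by have := ext_mulZl 0 0 v; rewrite !scale0r. Qed.

Lemma ext_mul0r v : ext_mul v 0 = 0.
Proof. by have := ext_mulZr 0 v 0; rewrite !scale0r. Qed.

Lemma ext_mul_suml (I : finType) (g : I -> FH) v :
  ext_mul (\sum_i g i) v = \sum_i ext_mul (g i) v.
Proof.
exact: (big_morph (ext_mul^~ v) (fun x y => ext_mulDl x y v) (ext_mul0l v)).
Qed.

Lemma ext_mul_sumr (I : finType) (g : I -> FH) v :
  ext_mul v (\sum_i g i) = \sum_i ext_mul v (g i).
Proof.
exact: (big_morph (ext_mul v) (ext_mulDr v) (ext_mul0r v)).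
Qed.

Lemma ext_inM x y : ext_in (x * y) = ext_mul (ext_in x) (ext_in y).
Proof.
rewrite {1}(fbasis_sum x) {1}(fbasis_sum y) mulr_suml raddf_sum.
rewrite /ext_mul; apply: eq_bigr => i _.
rewrite mulr_sumr raddf_sum; apply: eq_bigr => j _ /=.
by rewrite -scalerAl -scalerAr !ext_inZ scalerA !mxE.
Qed.

Lemma ext_ind (P : FH -> Prop) :
  (forall x y, P x -> P y -> P (x + y)) -> (forall a x, P x -> P (a *: x)) ->
  (forall h, P (ext_in h)) -> forall u, P u.
Proof.
move=> PD PZ Pin u; rewrite (ext_sum u).
apply: (big_ind P) => // [|i _]; last exact/PZ/Pin.
by rewrite -(raddf0 ext_in).
Qed.

Lemma ext_mulA : associative ext_mul.
Proof.
move=> u v w; elim/ext_ind: u => [x y|a x|x].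
- by rewrite !ext_mulDl => -> ->.
- by rewrite !ext_mulZl => ->.
elim/ext_ind: v => [y z|a y|y].
- by rewrite ext_mulDl !ext_mulDr ext_mulDl => -> ->.
- by rewrite ext_mulZl !ext_mulZr ext_mulZl => ->.
elim/ext_ind: w => [z t|a z|z]; last by rewrite -!ext_inM mulrA.
- by rewrite !ext_mulDr => -> ->.
by rewrite !ext_mulZr => ->.
Qed.

Lemma ext_mul1l : left_id ext_one ext_mul.
Proof.
move=> u; rewrite [in LHS](ext_sum u) ext_mul_sumr [in RHS](ext_sum u).
by apply: eq_bigr => i _; rewrite ext_mulZr -ext_inM mul1r.
Qed.

Lemma ext_mul1r : right_id ext_one ext_mul.
Proof.
move=> u; rewrite [in LHS](ext_sum u) ext_mul_suml [in RHS](ext_sum u).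
by apply: eq_bigr => i _; rewrite ext_mulZl -ext_inM mulr1.
Qed.

Lemma ext_one_neq0 : ext_one != 0.
Proof.
apply/eqP => one0.
have all0 (u : FH) : u = 0 by rewrite -(ext_mul1l u) one0 ext_mul0l.
have /eqP : (1 : H) = 0.
  rewrite (fbasis_sum 1) big1 // => i _.
  have /matrixP/(_ 0 i)/eqP := all0 (delta_mx 0 i : 'rV[F]_(dim H)).
  by rewrite !mxE !eqxx oner_eq0.
by rewrite oner_eq0.
Qed.

HB.instance Definition _ := GRing.Zmodule_isNzRing.Build FH
  ext_mulA ext_mul1l ext_mul1r ext_mulDl ext_mulDr ext_one_neq0.

Lemma ext_scalerAl a (u v : FH) : a *: (u * v) = (a *: u) * v.
Proof. by rewrite -[RHS]/(ext_mul _ _) ext_mulZl. Qed.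

HB.instance Definition _ := GRing.Lmodule_isLalgebra.Build F FH ext_scalerAl.

Lemma ext_scalerAr a (u v : FH) : a *: (u * v) = u * (a *: v).
Proof. by rewrite -[RHS]/(ext_mul _ _) ext_mulZr. Qed.

HB.instance Definition _ := GRing.Lalgebra_isAlgebra.Build F FH ext_scalerAr.

Lemma ext_in_is_monoid_morphism : monoid_morphism ext_in.
Proof. by split=> // x y; rewrite ext_inM. Qed.

HB.instance Definition _ :=
  GRing.isMonoidMorphism.Build H FH ext_in ext_in_is_monoid_morphism.

(* id (x) phi *)
Definition ext_map (phi : {lrmorphism H -> H}) (u : FH) : FH :=
  \sum_i u 0 i *: ext_in (phi (e i)).

Section ExtMap.
Variable phi : {lrmorphism H -> H}.

Lemma ext_map_is_linear : linear (ext_map phi).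
Proof.
move=> a u v; rewrite /ext_map scaler_sumr -big_split /=.
by apply: eq_bigr => i _; rewrite !mxE scalerDl scalerA.
Qed.

HB.instance Definition _ :=
  GRing.isLinear.Build F FH FH _ (ext_map phi) ext_map_is_linear.

Lemma ext_map_in h : ext_map phi (ext_in h) = ext_in (phi h).
Proof.
rewrite [in RHS](fbasis_sum h) linear_sum raddf_sum.
by apply: eq_bigr => i _ /=; rewrite linearZ /= ext_inZ mxE.
Qed.

Lemma ext_map_is_monoid_morphism : monoid_morphism (ext_map phi).
Proof.
split=> [|u v]; first by have := ext_map_in 1; rewrite !rmorph1.
elim/ext_ind: u => [x y|a x|x].
- by rewrite mulrDl !linearD /= mulrDl => -> ->.
- by rewrite -scalerAl !linearZ /= -scalerAl => ->.
elim/ext_ind: v => [y z|a y|y].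
- by rewrite mulrDr !linearD /= mulrDr => -> ->.
- by rewrite -scalerAr !linearZ /= -scalerAr => ->.
by rewrite -rmorphM !ext_map_in !rmorphM.
Qed.

HB.instance Definition _ :=
  GRing.isMonoidMorphism.Build FH FH (ext_map phi) ext_map_is_monoid_morphism.

End ExtMap.

End ScalarExtension.

Arguments ext_in {A F} f {H} h.
Arguments ext_map {A F} f {H} phi u.

(* A finite-dimensional left B-module, given as a matrix representation: B     *)
(* acts on column vectors of height mdim.                                      *)
Record fdmod (F : fieldType) (B : algType F) := FdMod {
  mdim : nat;
  mact :> B -> 'M[F]_mdim;
  mact_is_linear : linear mact;
  mact_is_monoid_morphism : monoid_morphism mact
}.

HB.instance Definition _ (F : fieldType) (B : algType F) (V : fdmod B) :=
  GRing.isLinear.Build F B 'M[F]_(mdim V) _ (mact V) (@mact_is_linear F B V).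
HB.instance Definition _ (F : fieldType) (B : algType F) (V : fdmod B) :=
  GRing.isMonoidMorphism.Build B 'M[F]_(mdim V) (mact V)
    (@mact_is_monoid_morphism F B V).
HB.instance Definition _ (F : fieldType) (B : algType F) :=
  gen_eqMixin (fdmod B).
HB.instance Definition _ (F : fieldType) (B : algType F) :=
  gen_choiceMixin (fdmod B).

Section Modules.
Variables (F : fieldType) (B : algType F).
Implicit Types U V W : fdmod B.

Definition mod_hom V W (g : 'M[F]_(mdim W, mdim V)) : Prop :=
  forall b, g *m V b = W b *m g.

Arguments mod_hom : clear implicits.

Definition isom V W : Prop :=
  exists (g : 'M[F]_(mdim W, mdim V)) (g' : 'M[F]_(mdim V, mdim W)),
    [/\ mod_hom V W g, g' *m g = 1%:M & g *m g' = 1%:M].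

Definition submod V (X : {vspace 'cV[F]_(mdim V)}) : Prop :=
  forall b u, u \in X -> V b *m u \in X.

Arguments submod : clear implicits.

Definition simple_mod V : Prop :=
  (0 < mdim V)%N /\
  forall X : {vspace 'cV[F]_(mdim V)}, submod V X -> X = 0%VS \/ X = fullv.

Definition semisimple_mod V : Prop :=
  forall X : {vspace 'cV[F]_(mdim V)}, submod V X ->
    exists Y : {vspace 'cV[F]_(mdim V)},
      [/\ submod V Y, (X + Y)%VS = fullv & (X :&: Y)%VS = 0%VS].

Definition short_exact U V W
    (g : 'M[F]_(mdim V, mdim U)) (g' : 'M[F]_(mdim W, mdim V)) : Prop :=
  [/\ mod_hom U V g, mod_hom V W g',
      forall u : 'cV[F]_(mdim U), g *m u = 0 -> u = 0,
      forall w : 'cV[F]_(mdim W), exists v, g' *m v = w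
    & forall v : 'cV[F]_(mdim V), g' *m v = 0 <-> exists u, v = g *m u].

Arguments short_exact : clear implicits.

(* A complete irredundant family of representatives of the isomorphism classes *)
(* of simple modules.                                                          *)
Definition irr_family (I : finType) (S : I -> fdmod B) : Prop :=
  [/\ forall i, simple_mod (S i),
      forall i j, isom (S i) (S j) -> i = j
    & forall V, simple_mod V -> exists i, isom V (S i)].

Definition twist (sigma : {lrmorphism B -> B}) V : fdmod B.
Proof.
apply: (@FdMod F B (mdim V) (fun b => V (sigma b))) => [a x y|].
  by rewrite linearP linearP.
by split=> [|x y]; rewrite ?rmorph1 ?rmorphM.
Defined.

(* The subgroup of the free abelian group on all finite-dimensional modules    *)
(* generated by the V - U - W with 0 -> U -> V -> W -> 0 exact.                *)
Inductive ses_span : {freeg (fdmod B) / int} -> Prop :=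
| ses_span0 : ses_span 0
| ses_spanB x y : ses_span x -> ses_span y -> ses_span (x - y)
| ses_span_ses U V W g g' : short_exact U V W g g' ->
    ses_span (<< V >> - << U >> - << W >>).

Definition ses_pred : pred {freeg (fdmod B) / int} := fun x => `[< ses_span x >].

Lemma ses_pred_zmod_closed : zmod_closed ses_pred.
Proof.
split=> [|x y]; first exact/asboolP/ses_span0.
by move=> /asboolP hx /asboolP hy; apply/asboolP/ses_spanB.
Qed.

Definition ses_subgroup : zmodClosed {freeg (fdmod B) / int} :=
  HB.pack ses_pred
    (GRing.isZmodClosed.Build {freeg (fdmod B) / int} ses_pred
       ses_pred_zmod_closed).

Definition R0 : zmodType := {ideal_quot ses_subgroup}.

Definition R0_class V : R0 := (\pi_({ideal_quot ses_subgroup}) << V >>)%qT.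

End Modules.

Arguments mod_hom {F B} V W g.
Arguments submod {F B} V X.
Arguments short_exact {F B} U V W g g'.
Arguments R0 {F} B.

Definition split_alg (F : fieldType) (B : algType F) : Prop :=
  forall V : fdmod B, simple_mod V ->
    forall g : 'M[F]_(mdim V), mod_hom V V g -> is_scalar_mx g.

Definition semisimple_alg (F : fieldType) (B : algType F) : Prop :=
  forall V : fdmod B, semisimple_mod V.

Notation frac_ext H := (scalar_ext (@FracField.tofrac _) H).

Section Decomposition.
Variables (A : idomainType) (L : fieldType) (theta : {rmorphism A -> L}).
Variable H : freeAlgType A.

(* d_theta [V] is the class of a module W such that, for all h in H, the       *)
(* characteristic polynomial of h on V has coefficients in A, and theta maps   *)
(* it to the characteristic polynomial of h on W.                              *)
Definition is_decomposition_map
    (dtheta : {additive R0 (frac_ext H) -> R0 (scalar_ext theta H)}) : Prop :=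
  forall V : fdmod (frac_ext H), exists W : fdmod (scalar_ext theta H),
    dtheta (R0_class V) = R0_class W /\
    forall h : H, exists p : {poly A},
      char_poly (V (ext_in _ h)) = map_poly (@FracField.tofrac A) p /\
      char_poly (W (ext_in _ h)) = map_poly theta p.

Definition are_decomposition_numbers
    (dtheta : {additive R0 (frac_ext H) -> R0 (scalar_ext theta H)})
    (Lambda I : finType) (V : Lambda -> fdmod (frac_ext H))
    (S : I -> fdmod (scalar_ext theta H)) (d : Lambda -> I -> nat) : Prop :=
  forall l, dtheta (R0_class (V l)) = \sum_(M : I) R0_class (S M) *+ d l M.

End Decomposition.

Section BasicSets.
Variables Lambda I : finType.
Implicit Types (le : rel Lambda) (B : {set Lambda}).

Definition total_order le : Prop :=
  [/\ reflexive le, antisymmetric le, transitive le & total le].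

Definition unitriangular_basic_set (d : Lambda -> I -> nat) B le
    (Psi : {l : Lambda | l \in B} -> I) : Prop :=
  [/\ total_order le, bijective Psi,
      forall l, d (val l) (Psi l) = 1%N
    & forall (M : I) (l : Lambda) (b : {l : Lambda | l \in B}),
        Psi b = M -> ~~ le l (val b) -> d l M = 0%N].

Definition max_of le (x y : Lambda) : Lambda := if le x y then y else x.

Definition preceq le (lprime : Lambda -> Lambda) : rel Lambda := fun l m =>
  [|| l == m, (l == lprime m) && le (lprime m) m
    | let M := max_of le l (lprime l) in
      let N := max_of le m (lprime m) in (M != N) && le M N].

Section Modified.
Variables (B : {set Lambda}) (le : rel Lambda).
Variable Psi : {l : Lambda | l \in B} -> I.
Variables (lprime : Lambda -> Lambda).
Variable m : {l : Lambda | l \in B} -> {l : Lambda | l \in B}.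

Definition Theta (b : {l : Lambda | l \in B}) : Lambda :=
  max_of (preceq le lprime) (val b) (lprime (val (m b))).

Definition Btilde : {set Lambda} := [set l in codom Theta].

Lemma Btilde_codom (l : {l : Lambda | l \in Btilde}) : val l \in codom Theta.
Proof. by have := valP l; rewrite inE. Qed.

(* iinv picks an antecedent of val l under Theta; it is unique as Theta is     *)
(* injective.                                                                  *)
Definition Psi_tilde (l : {l : Lambda | l \in Btilde}) : I :=
  Psi (iinv (Btilde_codom l)).

End Modified.
End BasicSets.

Arguments unitriangular_basic_set {Lambda I} d B le Psi.
Arguments Theta {Lambda B} le lprime m b.
Arguments Btilde {Lambda B} le lprime m.
Arguments Psi_tilde {Lambda I B} le Psi lprime m l.

(* Main.v *)
Require Import Defs.
From HB Require Import structures.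
From mathcomp Require Import all_boot all_order all_algebra.
From mathcomp Require Import boolp.
From mathcomp.multinomials Require Import freeg.
Import GRing.Theory.
Local Open Scope ring_scope.

(** Write [p] for the involution [l |-> l'] of [Lambda] and [m] for the one of
    [B]. The theorem follows, by pure order combinatorics, from one symmetry of
    the decomposition matrix ([decomposition_numbers_twist]): twisting both
    arguments by [phi] does not change an entry, that is
    [d (p l) (Psi (m b)) = d l (Psi b)].

    The symmetry. A decomposition map is only known through characteristic
    polynomials, and applying [theta] to the characteristic polynomial of
    [phi h] on [V] gives the one of [h] on the twist of [V]. Hence, if [W] and
    [W'] are reductions of [V l] and [V (p l)], then [h] has on [W'] the
    characteristic polynomial that [phi h] has on [W]. It remains to recover
    multiplicities of simple modules from characteristic polynomials (the
    Brauer-Nesbitt principle). As the algebra over [L] is split, the Jacobson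
    density theorem ([density]) gives an element acting as a rank one
    idempotent on one simple module and as zero on all the others. Since [L] is
    the field of fractions of the image of [theta], a nonzero multiple of this
    element, by a scalar [c], comes from [H] ([exists_separating_element]).
    Characteristic polynomials are multiplicative in short exact sequences, so
    that the multiplicity of the root [c] is additive on the Grothendieck group
    ([mup_char_poly_R0]), and it counts the occurrences of the chosen simple
    module. Multiplicities of roots are used instead of traces because the
    characteristic of [L] may be positive.

    The combinatorics. The modified order is the lexicographic order on the
    pairs [(max (l, p l), l)] ([preceqE]). Unitriangularity and the symmetry
    give [d (p (m b)) (Psi b) = 1] and, whenever [d l (Psi b)] is nonzero, both
    [l <= b] and [p l <= m b]. So the larger of [b] and [m b] bounds the whole
    orbit [{l, p l}], and this larger element is the maximum of the orbit of
    [Theta b]. If the two maxima agree, then [l] is [Theta b] or [p (Theta b)],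
    and [l <= b] settles the comparison ([preceq_Theta]). *)

Set Implicit Arguments.
Unset Strict Implicit.
Unset Printing Implicit Defensive.

(** * Characteristic polynomials and short exact sequences *)

Lemma char_poly_intertwine (R : fieldType) n m (M : 'M[R]_n) (N : 'M[R]_m)
    (P : 'M[R]_(n, m)) (P' : 'M[R]_(m, n)) :
  M *m P = P *m N -> P *m P' = 1%:M -> P' *m P = 1%:M ->
  char_poly M = char_poly N.
Proof.
move=> MP PP' P'P.
have Enm : n = m.
  apply/eqP; rewrite eqn_leq; apply/andP; split.
    have := mxrankM_maxl P P'.
    by rewrite PP' mxrank1 => /leq_trans; apply; exact: rank_leq_col.
  have := mxrankM_maxl P' P.
  by rewrite P'P mxrank1 => /leq_trans; apply; exact: rank_leq_col.
case: m / Enm N P P' MP PP' P'P => N P P' MP PP' P'P.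
have -> : M = P *m N *m P' by rewrite -MP -mulmxA PP' mulmx1.
rewrite /char_poly /char_poly_mx !map_mxM.
have PP'X : map_mx (@polyC R) P *m map_mx (@polyC R) P' = 1%:M.
  by rewrite -map_mxM PP' map_mx1.
rewrite -[X in X - _]mulmx1 -PP'X mulmxA -scalar_mxC.
by rewrite -mulmxBl -mulmxBr !det_mulmx mulrAC -det_mulmx PP'X det1 mul1r.
Qed.

Lemma char_poly_isom (F : fieldType) (B : algType F) (U W : fdmod B) :
  isom U W -> forall b, char_poly (U b) = char_poly (W b).
Proof.
move=> [g [g' [hg g'g gg']]] b; apply/esym.
exact: (@char_poly_intertwine _ _ _ _ _ g g').
Qed.

Lemma mx_col_ext (R : pzRingType) m n (M N : 'M[R]_(m, n)) :
  (forall u : 'cV_n, M *m u = N *m u) -> M = N.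
Proof.
move=> eqMN; apply/trmx_inj/row_matrixP => i.
by rewrite -!tr_col !colE eqMN.
Qed.

Lemma char_poly_ublock (R : comNzRingType) n m (M : 'M[R]_n) (N : 'M[R]_m) C :
  char_poly (block_mx M C 0 N) = char_poly M * char_poly N.
Proof.
rewrite /char_poly /char_poly_mx map_block_mx map_mx0.
by rewrite scalar_mx_block opp_block_mx add_block_mx oppr0 addr0 det_ublock.
Qed.

(** Converts the pointwise surjectivity and exactness conditions of
    [short_exact], which speak of column vectors, into matrix equations. *)
Lemma mulmx_factor (R : pzRingType) m n p (g : 'M[R]_(m, n)) (M : 'M_(m, p)) :
  (forall j, exists u : 'cV_n, col j M = g *m u) -> exists N, M = g *m N.
Proof.
move=> /fin_all_exists[u uP]; exists (\matrix_(r, j) u j r 0).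
apply/matrixP => i j; have /colP/(_ i) := uP j; rewrite !mxE => ->.
by apply: eq_bigr => k _; rewrite mxE.
Qed.

(** A section [s] of [g'] and the retraction [r] of [g] that it determines
    identify [V] with [U + W]; in these coordinates [V b] is block upper
    triangular, with [U b] and [W b] on the diagonal. *)
Lemma char_poly_short_exact (F : fieldType) (B : algType F) (U V W : fdmod B)
    g g' : short_exact U V W g g' ->
  forall b, char_poly (V b) = char_poly (U b) * char_poly (W b).
Proof.
move=> [hg hg' inj surj ex] b.
have [s /esym g's] : exists s, 1%:M = g' *m s.
  by apply: mulmx_factor => j; have [v <-] := surj (col j 1%:M); exists v.
have g'g : g' *m g = 0.
  by apply: mx_col_ext => u; rewrite mul0mx -mulmxA; apply/ex; exists u.
have ker_factor n (M : 'M_(mdim V, n)) : g' *m M = 0 -> exists N, M = g *m N.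
  move=> g'M; apply: mulmx_factor => j.
  by apply/ex; rewrite colE mulmxA g'M mul0mx.
have [r rP] : exists r, 1%:M - s *m g' = g *m r.
  by apply: ker_factor; rewrite mulmxBr mulmx1 mulmxA g's mul1mx subrr.
have ginj n (M N : 'M_(_, n)) : g *m M = g *m N -> M = N.
  move=> gMN; apply: mx_col_ext => u; apply/eqP; rewrite -subr_eq0; apply/eqP.
  by apply: inj; rewrite mulmxBr !mulmxA gMN subrr.
have rg : r *m g = 1%:M.
  apply: ginj; rewrite mulmxA -rP mulmxBl mul1mx -mulmxA g'g mulmx0 subr0.
  by rewrite mulmx1.
have rs : r *m s = 0.
  apply: ginj; rewrite mulmxA -rP mulmxBl mul1mx -mulmxA g's mulmx1 subrr.
  by rewrite mulmx0.
have [C CP] : exists C, V b *m s - s *m W b = g *m C.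
  apply: ker_factor; rewrite mulmxBr !mulmxA hg' g's mul1mx -mulmxA g's.
  by rewrite mulmx1 subrr.
rewrite -(char_poly_ublock _ _ C).
apply: (@char_poly_intertwine _ _ _ _ _ (row_mx g s) (col_mx r g')).
- by rewrite mul_mx_row mul_row_block mulmx0 addr0 -CP hg subrK.
- by rewrite mul_row_col -rP subrK.
- by rewrite mul_col_row rg rs g'g g's -scalar_mx_block.
Qed.

(** * Additive functions on the Grothendieck group *)

(** A function additive in short exact sequences extends to the free group on
    modules and vanishes on the relations, hence is compatible with equalities
    of classes. *)
Lemma R0_class_sum (F : fieldType) (B : algType F) (f : fdmod B -> int) :
  (forall U V W g g', short_exact U V W g g' -> f V = f U + f W) ->
  forall (I : finType) (S : I -> fdmod B) (d : I -> nat) (W : fdmod B),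
    R0_class W = \sum_i R0_class (S i) *+ d i -> f W = \sum_i f (S i) *+ d i.
Proof.
move=> f_ses I S d W eqW.
pose lf := fglift (f : fdmod B -> int^o).
have lfB x y : lf (x - y) = lf x - lf y.
  exact: (lift_is_additive (M := int^o)).
have lf0 : lf 0 = 0 by rewrite -(subrr 0) lfB subrr.
have lfD x y : lf (x + y) = lf x + lf y.
  by rewrite -[y in LHS]opprK lfB -(sub0r y) lfB lf0 sub0r opprK.
have lfU V : lf << V >> = f V.
  by rewrite /lf (liftU (M := int^o)) /= -[LHS]/(1 * f V) mul1r.
have lf_ses x : ses_span x -> lf x = 0.
  elim => {x} [//|x y _ x0 _ y0|U V X g g' /f_ses fV].
    by rewrite lfB x0 y0 subrr.
  by rewrite !lfB !lfU fV addrAC addrK subrr.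
have lfsum : lf (\sum_i << S i >> *+ d i) = \sum_i f (S i) *+ d i.
  rewrite (big_morph lf lfD lf0); apply: eq_bigr => i _.
  by elim: (d i) => [|n IH]; rewrite ?mulr0n ?mulrS ?lfD ?IH ?lfU.
rewrite -lfsum -lfU; apply/eqP; rewrite -subr_eq0 -lfB; apply/eqP/lf_ses.
apply/asboolP; rewrite -[X in is_true X]/(_ \in ses_subgroup B).
rewrite Quotient.idealrBE; apply/eqP.
rewrite [LHS]eqW raddf_sum; apply: eq_bigr => i _.
by rewrite raddfMn.
Qed.

(** Only simple modules having [c] as an eigenvalue of [b] contribute, which is
    how multiplicities of simple modules are read off. *)
Lemma mup_char_poly_R0 (F : fieldType) (B : algType F) (I : finType)
    (S : I -> fdmod B) (d : I -> nat) (W : fdmod B) :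
  R0_class W = \sum_i R0_class (S i) *+ d i ->
  forall (c : F) (b : B),
    mup c (char_poly (W b)) = (\sum_i mup c (char_poly (S i b)) * d i)%N.
Proof.
move=> eqW c b; pose f (V : fdmod B) : int := mup c (char_poly (V b)).
have f_ses U V X g g' : short_exact U V X g g' -> f V = f U + f X.
  move/char_poly_short_exact => VE.
  by rewrite /f VE mupM ?monic_neq0 ?char_poly_monic // PoszD.
apply/eqP; rewrite -eqz_nat; apply/eqP.
rewrite -/(f W) (R0_class_sum f_ses eqW).
rewrite (big_morph Posz PoszD (erefl _)); apply: eq_bigr => i _.
by rewrite PoszM -mulr_natr natz.
Qed.

(** * The density theorem *)

(** Simplicity of a module quantifies over detachable subspaces, whereas
    kernels, images and orbits of left ideals arise as propositional
    predicates. A subspace of maximal dimension among those contained in [P] is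
    all of [P]. *)
Lemma vspace_of_linear_pred (F : fieldType) (vT : vectType F) (P : vT -> Prop) :
  P 0 -> (forall a u v, P u -> P v -> P (a *: u + v)) ->
  exists X : {vspace vT}, forall v, v \in X <-> P v.
Proof.
move=> P0 Plin.
pose inP (X : {vspace vT}) := forall v, v \in X -> P v.
pose Q n := `[< exists2 X, inP X & \dim X = n >].
have exQ : exists n, Q n.
  exists 0%N; apply/asboolP; exists 0%VS; last exact: dimv0.
  by move=> v; rewrite memv0 => /eqP->.
have ubQ n : Q n -> (n <= \dim {: vT})%N.
  by move=> /asboolP[X _ <-]; apply/dimvS/subvf.
case: (ex_maxnP exQ ubQ) => n /asboolP[X XP dimX] maxn; exists X => v.
split=> [/XP//|Pv]; apply/negPn/negP => Xv.
have : (n.+1 <= n)%N; last by rewrite ltnn.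
apply: maxn; apply/asboolP; exists (X + <[v]>)%VS.
  move=> _ /memv_addP[x /XP Px [_ /vlineP[k ->] ->]].
  by rewrite addrC; apply: Plin.
rewrite dimv_disjoint_sum ?dimX; last first.
  apply/eqP; rewrite -subv0; apply/subvP => x; rewrite memv_cap memv0.
  move=> /andP[Xx /vlineP[k xE]]; move: Xx; rewrite xE.
  have [->|k0] := eqVneq k 0; first by rewrite scale0r.
  by rewrite rpredZeq (negPf k0) (negPf Xv).
rewrite dim_vline; case: eqP Xv => [->|]; first by rewrite mem0v.
by rewrite addn1.
Qed.

Section Density.
Variables (F : fieldType) (B : algType F).
Implicit Types U V W : fdmod B.

Lemma mactM V b c : V (b * c) = V b *m V c.
Proof. by rewrite rmorphM. Qed.

Lemma simple_mod_pred V : simple_mod V ->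
  forall P : 'cV[F]_(mdim V) -> Prop,
    P 0 -> (forall a u v, P u -> P v -> P (a *: u + v)) ->
    (forall b u, P u -> P (V b *m u)) ->
  (forall u, P u -> u = 0) \/ (forall u, P u).
Proof.
move=> [_ simV] P P0 Plin Pact.
have [X XP] := vspace_of_linear_pred P0 Plin.
have [|X0|XT] := simV X; first by move=> b u /XP Pu; apply/XP/Pact.
  by left=> u /XP; rewrite X0 memv0 => /eqP.
by right=> u; apply/XP; rewrite XT memvf.
Qed.

Lemma Schur V W g : simple_mod V -> simple_mod W -> mod_hom V W g ->
  g = 0 \/ isom V W.
Proof.
move=> simV simW homg.
have [ker0|kerT] : (forall u : 'cV_(mdim V), g *m u = 0 -> u = 0) \/
                   (forall u : 'cV_(mdim V), g *m u = 0).
- apply: (simple_mod_pred simV (P := fun u => g *m u = 0)).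
  + exact: mulmx0.
  + by move=> a u v gu gv; rewrite mulmxDr -scalemxAr gu gv scaler0 addr0.
  + by move=> b u gu; rewrite mulmxA homg -mulmxA gu mulmx0.
- have [im0|imT] : (forall w : 'cV_(mdim W), (exists u, w = g *m u) -> w = 0) \/
                   (forall w : 'cV_(mdim W), exists u, w = g *m u).
  + apply: (simple_mod_pred simW (P := fun w => exists u, w = g *m u)).
    * by exists 0; rewrite mulmx0.
    * move=> a _ _ [u ->] [v ->]; exists (a *: u + v).
      by rewrite mulmxDr -scalemxAr.
    * by move=> b _ [u ->]; exists (V b *m u); rewrite !mulmxA homg.
  + by left; apply: mx_col_ext => u; rewrite mul0mx; apply: im0; exists u.
  right; have [g' gg'] : exists g', 1%:M = g *m g' by exact: mulmx_factor.
  exists g, g'; split=> //; apply: mx_col_ext => u.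
  apply/eqP; rewrite -subr_eq0; apply/eqP/ker0.
  by rewrite -mulmxBl mulmxA mulmxBr mulmxA -gg' mul1mx mulmx1 subrr mul0mx.
- by left; apply: mx_col_ext => u; rewrite mul0mx.
Qed.

Definition left_ideal (J : B -> Prop) : Prop :=
  [/\ J 0, forall a b c, J b -> J c -> J (a *: b + c)
    & forall b c, J c -> J (b * c)].

Lemma simple_left_ideal V (J : B -> Prop) (w : 'cV_(mdim V)) :
  simple_mod V -> left_ideal J ->
  (forall b, J b -> V b *m w = 0) \/ (forall u, exists2 b, J b & V b *m w = u).
Proof.
move=> simV [J0 Jlin Jmul].
have [im0|] : (forall u, (exists2 b, J b & V b *m w = u) -> u = 0) \/
              (forall u, exists2 b, J b & V b *m w = u); last by right.
  apply: (simple_mod_pred simV (P := fun u => exists2 b, J b & V b *m w = u)).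
  - by exists 0; rewrite ?linear0 ?mul0mx.
  - move=> a _ _ [b Jb <-] [c Jc <-]; exists (a *: b + c); first exact: Jlin.
    by rewrite linearP mulmxDl -scalemxAl.
  - move=> c _ [b Jb <-]; exists (c * b); first exact: Jmul.
    by rewrite mactM mulmxA.
by left=> b Jb; apply: im0; exists b.
Qed.

Variables (I : finType) (S : I -> fdmod B).
Hypothesis S_simple : forall i, simple_mod (S i).
Hypothesis S_isom : forall i j, isom (S i) (S j) -> i = j.
Hypothesis B_split : split_alg B.

Local Notation vec := {i : I & 'cV[F]_(mdim (S i))}.

Definition kills (xs : seq vec) (b : B) : Prop :=
  forall x, x \in xs -> S (tag x) b *m tagged x = 0.

Lemma kills_left_ideal xs : left_ideal (kills xs).
Proof.
split=> [x _|a b c Jb Jc x xs_x|b c Jc x xs_x].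
- by rewrite linear0 mul0mx.
- by rewrite linearP mulmxDl -scalemxAl Jb // Jc // scaler0 addr0.
- by rewrite mactM -mulmxA Jc ?mulmx0.
Qed.

(** The vector of [x] if it lies in [S i], and [0] otherwise: the zeros coming
    from other modules are harmless in a span. *)
Definition component i (x : vec) : 'cV[F]_(mdim (S i)) :=
  @untag I (fun i => 'cV[F]_(mdim (S i))) _ 0 i id x.

Lemma componentT i (v : 'cV_(mdim (S i))) :
  component i (Tagged (fun i => 'cV_(mdim (S i))) v) = v.
Proof.
by rewrite /component /untag; case: eqP => // e; rewrite (eq_axiomK e).
Qed.

(** Jacobson density for several modules at once, by induction on [xs]. Let [J]
    be the left ideal killing the tail [xs] and [w], in [S k], the head. Either
    [J] kills [w], and the head may be dropped, or [J w] is the whole of [S k]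
    and [b w |-> b v] (for [b] in [J]) is a well defined homomorphism from
    [S k] to [S i]. By Schur's lemma and splitness it is [0], or [k = i] and it
    is a scalar [a]; then [J] kills [v] or [v - a w] respectively. *)
Lemma density (xs : seq vec) i (v : 'cV_(mdim (S i))) :
  (forall b, kills xs b -> S i b *m v = 0) ->
  v \in <<[seq component i x | x <- xs]>>%VS.
Proof.
elim: xs i v => [|[k w] xs IH] i v.
  by move/(_ 1); rewrite rmorph1 mul1mx => -> //; rewrite mem0v.
move=> killv; have sub_span : (<<[seq component i x | x <- xs]>>
    <= <<[seq component i x | x <- Tagged _ w :: xs]>>)%VS.
  by apply: sub_span => x xs_x; rewrite inE xs_x orbT.
have killv' b : kills xs b -> S k b *m w = 0 -> S i b *m v = 0.
  move=> Jb bw; apply: killv => x; rewrite inE => /predU1P[->//|]; exact: Jb.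
have [J0 Jlin Jmul] := kills_left_ideal xs.
have [w0|wT] := simple_left_ideal w (S_simple k) (kills_left_ideal xs).
  by apply/(subvP sub_span)/IH => b Jb; apply: killv' => //; apply: w0.
have [bj bj_kills bjw] := fin_all_exists2 (fun j => wT (delta_mx j 0)).
(* [bj j] is an element of the left ideal sending [w] to the [j]-th basis
   vector; the [j]-th column of [g] is forced to be [S i (bj j) *m v]. *)
have [g gP] : exists g, forall b,
    kills xs b -> S i b *m v = g *m (S k b *m w).
  exists (\matrix_(r, j) (S i (bj j) *m v) r 0) => b Jb.
  set u := S k b *m w.
  pose c := \sum_j u j 0 *: bj j.
  have Jc : kills xs c.
    apply: (big_ind (kills xs)) => // [x y Jx Jy|j _].
      by rewrite -[x]scale1r; apply: Jlin.
    by rewrite -[_ *: _]addr0; apply: Jlin.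
  have cw : S k c *m w = u.
    rewrite linear_sum mulmx_suml [RHS]matrix_sum_delta; apply: eq_bigr => j _.
    by rewrite big_ord1 linearZ -scalemxAl bjw.
  have /eqP : S i (-1 *: c + b) *m v = 0.
    apply: killv'; first exact: Jlin.
    by rewrite linearP mulmxDl -scalemxAl cw scaleN1r addNr.
  rewrite linearP mulmxDl -scalemxAl scaleN1r addrC subr_eq0 => /eqP->.
  rewrite linear_sum mulmx_suml; apply/colP => r.
  rewrite summxE mxE; apply: eq_bigr => j _.
  by rewrite linearZ -scalemxAl !mxE mulrC.
have homg : mod_hom (S k) (S i) g.
  move=> c; apply: mx_col_ext => u; have [b Jb <-] := wT u.
  rewrite -!mulmxA -gP // [S k c *m _]mulmxA -mactM -gP; last exact: Jmul.
  by rewrite mactM mulmxA.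
have [g0|/S_isom Eki] := Schur (S_simple k) (S_simple i) homg.
  by apply/(subvP sub_span)/IH => b Jb; rewrite gP // g0 mul0mx.
case: i / Eki v g homg gP IH {killv killv'} sub_span => v g homg gP IH sub_span.
have [a gE] := is_scalar_mxP (B_split (S_simple k) homg).
rewrite -[v](subrK (a *: w)) memvD //.
  apply/(subvP sub_span)/IH => b Jb.
  by rewrite mulmxBr -scalemxAr gP // gE mul_scalar_mx subrr.
by apply/memvZ/memv_span; rewrite /= componentT mem_head.
Qed.

(** Density applied to all the standard basis vectors of all the [S k] but one,
    [delta_mx j 0] in [S i], which is not in the span of the others. *)
Lemma exists_rank_one_idempotent i : exists (e : B) j,
  S i e = delta_mx j j /\ forall k, k != i -> S k e = 0.
Proof.
have j : 'I_(mdim (S i)) := Ordinal (S_simple i).1.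
pose idx := {k : I & 'I_(mdim (S k))}.
pose delta (x : idx) : vec := Tagged _ (delta_mx (tagged x) 0).
pose x0 : idx := Tagged _ j.
pose xs := [seq delta x | x <- rem x0 (enum {: idx})].
have coord0 y : y \in [seq component i x | x <- xs] -> y j 0 = 0.
  move=> /mapP[_ /mapP[x xs_x ->] {y}->].
  move: xs_x; rewrite (mem_rem_uniq _ (enum_uniq _)) !inE => /andP[xx0 _].
  rewrite /component /untag; case: eqP => [Ex|_]; last by rewrite mxE.
  case: x Ex xx0 => k s /= Ek; rewrite /x0.
  case: i / Ek j @x0 @xs => j _ _ xx0.
  rewrite mxE eqxx andbT.
  by case: (eqVneq j s) xx0 => [<-|//]; rewrite eqxx.
have kills_col e : kills xs e -> forall x : idx, x != x0 ->
    col (tagged x) (S (tag x) e) = 0.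
  move=> Je x xx0; rewrite colE; apply: (Je (delta x)).
  by apply: map_f; rewrite (mem_rem_uniq _ (enum_uniq _)) !inE xx0 mem_enum.
have [kill0|] :=
    simple_left_ideal (delta_mx j 0) (S_simple i) (kills_left_ideal xs).
  have := density kill0; set X := map _ _.
  move=> /(coord_span (X := in_tuple X))/colP/(_ j).
  rewrite !mxE !eqxx summxE big1 => [/eqP|t _]; first by rewrite oner_eq0.
  by rewrite mxE coord0 ?mulr0 ?mem_nth.
move=> /(_ (delta_mx j 0))[e Je eE]; exists e, j; split=> [|k ki].
  apply/trmx_inj/row_matrixP => t; rewrite -!tr_col; congr _^T.
  have [->|tj] := eqVneq t j.
    by rewrite colE eE colE mul_delta_mx.
  have /= -> := kills_col _ Je (Tagged _ t).
    by rewrite colE mul_delta_mx_0 1?eq_sym.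
  by rewrite eq_Tagged.
apply/trmx_inj/row_matrixP => t; rewrite -!tr_col; congr _^T.
have /= -> := kills_col _ Je (Tagged _ t); first by rewrite col0.
by apply: contraNneq ki => /(congr1 tag)/= ->.
Qed.
End Density.

(** * Separating simple modules by elements of [H] *)

Lemma mup_char_poly_scale_delta (F : fieldType) n (c : F) (j : 'I_n) :
  c != 0 -> mup c (char_poly (c *: delta_mx j j)) = 1%N.
Proof.
move=> c0; rewrite char_poly_trig; last first.
  apply/is_trig_mxP => r s rs; rewrite !mxE.
  case: eqP => [<-|]; rewrite ?mulr0 //.
  by case: eqP rs => [->|]; rewrite ?ltnn ?mulr0.
rewrite (bigD1 j) //= !mxE !eqxx mulr1 mupMl ?(mup_XsubCX 1) ?eqxx //.
rewrite /root horner_prod; apply/prodf_neq0 => t /negPf tj.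
by rewrite !hornerE !mxE tj mulr0 subr0.
Qed.

Lemma mup_char_poly0 (F : fieldType) n (c : F) :
  c != 0 -> mup c (char_poly (0 : 'M[F]_n)) = 0%N.
Proof.
move=> c0; rewrite char_poly_trig; last first.
  by apply/is_trig_mxP => r s _; rewrite mxE.
rewrite mupNroot // /root horner_prod; apply/prodf_neq0 => t _.
by rewrite !hornerE !mxE subr0.
Qed.

Lemma common_denominator (A : comNzRingType) (L : fieldType)
    (theta : {rmorphism A -> L}) (H : freeAlgType A) :
  field_of_fractions_of_image theta ->
  forall u : scalar_ext theta H, exists s h,
    theta s != 0 /\ theta s *: u = ext_in theta h.
Proof.
move=> L_frac; elim/ext_ind => [x y|a x|h].
- move=> [s [g [s0 sx]]] [t [h [t0 ty]]]; exists (s * t), (t *: g + s *: h).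
  rewrite rmorphM mulf_neq0 //; split=> //.
  by rewrite scalerDr raddfD /= !ext_inZ -sx -ty !scalerA [theta t * _]mulrC.
- move=> [s [g [s0 sx]]]; have [p [q [q0 ->]]] := L_frac a.
  exists (s * q), (p *: g); rewrite rmorphM mulf_neq0 //; split=> //.
  rewrite ext_inZ -sx !scalerA; congr (_ *: _).
  by rewrite mulrACA divff // mulr1 mulrC.
- by exists 1, h; rewrite rmorph1 oner_neq0 scale1r.
Qed.

(** The element [h] acts on [S i] as [c] times a rank one idempotent, and not as
    an idempotent, because denominators have to be cleared. *)
Lemma exists_separating_element (A : comNzRingType) (L : fieldType)
    (theta : {rmorphism A -> L}) (H : freeAlgType A)
    (I : finType) (S : I -> fdmod (scalar_ext theta H)) :
  field_of_fractions_of_image theta -> split_alg (scalar_ext theta H) ->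
  irr_family S ->
  forall i, exists (h : H) (c : L), forall k,
    mup c (char_poly (S k (ext_in theta h))) = (k == i).
Proof.
move=> L_frac LH_split [S_simple S_inj _] i.
have [e [j [eS eS0]]] := exists_rank_one_idempotent S_simple S_inj LH_split i.
have [s [h [s0 hE]]] := common_denominator L_frac e.
exists h, (theta s) => k; rewrite -hE linearZ.
have [->|ki] := eqVneq k i; first by rewrite /= eS mup_char_poly_scale_delta.
by rewrite /= eS0 // scaler0 mup_char_poly0.
Qed.

(** * Twisting by an automorphism *)

Section Twist.
Variables (F : fieldType) (B : algType F) (sigma : {lrmorphism B -> B}).
Implicit Types U V W : fdmod B.

Lemma isom_sym U V : isom U V -> isom V U.
Proof.
move=> [g [g' [homg g'g gg']]]; exists g', g; split=> // b.
by rewrite -[V b in LHS]mulmx1 -gg' (mulmxA (V b)) -homg !mulmxA g'g mul1mx.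
Qed.

Lemma isom_trans U V W : isom U V -> isom V W -> isom U W.
Proof.
move=> [g [g' [homg g'g gg']]] [f [f' [homf f'f ff']]].
exists (f *m g), (g' *m f'); split=> [b||].
- by rewrite -mulmxA homg mulmxA homf mulmxA.
- by rewrite mulmxA -(mulmxA g') f'f mulmx1.
- by rewrite mulmxA -(mulmxA f) gg' mulmx1.
Qed.

Lemma twist_isom U V : isom U V -> isom (twist sigma U) (twist sigma V).
Proof.
move=> [g [g' [homg g'g gg']]]; exists g, g'; split=> // b; exact: homg.
Qed.

Lemma twist_twist V : involutive sigma -> isom (twist sigma (twist sigma V)) V.
Proof.
move=> sigmaK; exists 1%:M, 1%:M.
by split; rewrite ?mulmx1 // => b; rewrite /= mul1mx mulmx1 sigmaK.
Qed.

Lemma twist_index_involutive (J : Type) (S : J -> fdmod B) (q : J -> J) :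
  involutive sigma -> (forall i j, isom (S i) (S j) -> i = j) ->
  (forall j, isom (twist sigma (S j)) (S (q j))) ->
  involutive q.
Proof.
move=> sigmaK S_inj qP j; apply/S_inj/isom_sym.
apply: isom_trans (isom_sym (twist_twist _ sigmaK)) _.
exact: isom_trans (twist_isom (qP j)) (qP (q j)).
Qed.
End Twist.

Lemma ext_map_involutive (A : comNzRingType) (F : fieldType)
    (f : {rmorphism A -> F}) (H : freeAlgType A) (phi : {lrmorphism H -> H}) :
  involutive phi -> involutive (ext_map f phi).
Proof.
move=> phiK; elim/ext_ind => [x y xK yK|a x xK|h].
- by rewrite !linearD /= xK yK.
- by rewrite !linearZ /= xK.
- by rewrite !ext_map_in phiK.
Qed.

(** * Symmetry of the decomposition matrix *)

Section DecompositionNumbers.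
Variables (A : idomainType) (L : fieldType) (theta : {rmorphism A -> L}).
Variable H : freeAlgType A.
Variable dtheta : {additive R0 (frac_ext H) -> R0 (scalar_ext theta H)}.
Hypothesis dtheta_dec : is_decomposition_map dtheta.

(** The reduction [p] of a characteristic polynomial is determined by it because
    [A] embeds in its field of fractions. *)
Lemma decomposition_map_twist (phi : {lrmorphism H -> H})
    (V V' : fdmod (frac_ext H)) :
  isom (twist (ext_map (@FracField.tofrac A) phi) V) V' ->
  exists W W', [/\ dtheta (R0_class V) = R0_class W,
    dtheta (R0_class V') = R0_class W' &
    forall h, char_poly (W' (ext_in theta h)) =
              char_poly (W (ext_in theta (phi h)))].
Proof.
move=> isoV; have [W [VW WP]] := dtheta_dec V.
have [W' [VW' WP']] := dtheta_dec V'.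
exists W, W'; split=> // h.
have [p [pV ->]] := WP (phi h); have [p' [pV' ->]] := WP' h; congr map_poly.
have tofrac_inj : injective (@FracField.tofrac A).
  by move=> x y /eqP; rewrite tofrac_eq => /eqP.
apply: (map_inj_poly tofrac_inj (rmorph0 _)).
by rewrite -pV -pV' -(char_poly_isom isoV) /= ext_map_in.
Qed.

Variables (Lambda I : finType).
Variable V : Lambda -> fdmod (frac_ext H).
Variable S : I -> fdmod (scalar_ext theta H).
Variable d : Lambda -> I -> nat.
Hypothesis d_dec : are_decomposition_numbers dtheta V S d.
Hypothesis L_frac : field_of_fractions_of_image theta.
Hypothesis LH_split : split_alg (scalar_ext theta H).
Hypothesis S_irr : irr_family S.
Variable phi : {lrmorphism H -> H}.

(** Both sides are the multiplicity of the same root [c]: on the reduction of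
    [V l'] for an element [h] separating [S (q i)], and on the reduction of
    [V l] for [phi h], which separates [S i]. *)
Lemma decomposition_numbers_twist (q : I -> I) l l' i :
  injective q ->
  (forall j, isom (twist (ext_map theta phi) (S j)) (S (q j))) ->
  isom (twist (ext_map (@FracField.tofrac A) phi) (V l)) (V l') ->
  d l' (q i) = d l i.
Proof.
move=> q_inj qP /decomposition_map_twist[W [W' [VW VW' eqW]]].
have [h [c hc]] := exists_separating_element L_frac LH_split S_irr (q i).
have := congr1 (mup c) (eqW h).
rewrite (mup_char_poly_R0 (etrans (esym VW') (d_dec l'))).
rewrite (mup_char_poly_R0 (etrans (esym VW) (d_dec l))).
rewrite (bigD1 (q i)) //= hc eqxx mul1n.
rewrite big1 ?addn0 => [->|j /negPf ji]; last first.
  by rewrite hc ji.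
rewrite (bigD1 i) //= -ext_map_in.
have twisted j :
    mup c (char_poly (S j (ext_map theta phi (ext_in theta h)))) = (j == i).
  rewrite -[S j _]/(twist _ (S j) _) (char_poly_isom (qP j)) hc.
  by rewrite (inj_eq q_inj).
rewrite twisted eqxx mul1n big1 ?addn0 // => j /negPf ji.
by rewrite twisted ji.
Qed.
End DecompositionNumbers.

(** * The modified order *)

Section ModifiedOrder.
Variables (T : finType) (le : rel T) (p : T -> T).
Hypotheses (le_total : total_order le) (pK : involutive p).

Let le_refl : reflexive le. Proof. by case: le_total. Qed.
Let le_anti : antisymmetric le. Proof. by case: le_total. Qed.
Let le_trans : transitive le. Proof. by case: le_total. Qed.
Let le_tot : total le. Proof. by case: le_total. Qed.

Local Notation M x := (max_of le x (p x)).

Lemma max_of_leP x y z : reflect (le x z /\ le y z) (le (max_of le x y) z).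
Proof.
rewrite /max_of; case: ifP => xy; apply: (iffP idP) => [|[]//] xz; split=> //.
  exact: le_trans xy xz.
by apply: le_trans xz; have := le_tot x y; rewrite xy.
Qed.

Lemma max_ofC x y : max_of le x y = max_of le y x.
Proof.
apply: le_anti; apply/andP; split; apply/max_of_leP.
  by have /max_of_leP[] := le_refl (max_of le y x).
by have /max_of_leP[] := le_refl (max_of le x y).
Qed.

Lemma max_of_orbit x y : M x = M y -> x = y \/ x = p y.
Proof.
rewrite /max_of; case: ifP => _; case: ifP => _ E; rewrite -?E ?pK; auto.
by left; apply: (can_inj pK).
Qed.

(** Elements with the same maximum are equal or exchanged by [p], so the middle
    clause of the definition is the order [le] inside a pair [{x, p x}]. *)
Lemma preceqE x y :
  preceq le p x y =
    (M x != M y) && le (M x) (M y) || (M x == M y) && le x y.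
Proof.
rewrite /preceq /=; have [E|NE] := eqVneq (M x) (M y); last first.
  rewrite /= orbF; case: eqVneq => [E|_]; first by rewrite E eqxx in NE.
  by case: eqVneq => [E|//]; rewrite E pK max_ofC eqxx in NE.
rewrite /= orbF; case: (eqVneq x y) => [->|nxy]; first by rewrite le_refl.
have [/eqP|xpy] := max_of_orbit E; first by rewrite (negPf nxy).
by rewrite xpy eqxx.
Qed.

Lemma preceq_total_order : total_order (preceq le p).
Proof.
split.
- by move=> x; rewrite preceqE eqxx /= le_refl.
- move=> x y; rewrite !preceqE [M y == _]eq_sym.
  case: eqVneq => [_|NE] /=; first exact: le_anti.
  by rewrite !orbF => /le_anti E; rewrite E eqxx in NE.
- move=> y x z; rewrite !preceqE.
  case: (eqVneq (M x) (M y)) => [->|Nxy] /=.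
    case: (eqVneq (M y) (M z)) => [_|//] /=; first exact: le_trans.
  rewrite orbF; case: (eqVneq (M y) (M z)) => [<-|Nyz] /=.
    by rewrite Nxy => ->.
  rewrite orbF => xy yz; rewrite (le_trans xy yz) andbT.
  have [E|//] := eqVneq (M x) (M z).
  by case/eqP: Nxy; apply: le_anti; rewrite xy E yz.
- move=> x y; rewrite !preceqE [M y == _]eq_sym.
  by case: eqVneq => _ /=; rewrite ?orbF; apply: le_tot.
Qed.

Lemma max_of_l (r : rel T) x y : antisymmetric r -> r y x -> max_of r x y = x.
Proof.
rewrite /max_of => anti yx; case: ifP => // xy.
by apply/anti; rewrite xy yx.
Qed.

Lemma preceq_le x y : le (M x) y -> M y = y -> preceq le p x y.
Proof.
move=> xy yE; rewrite preceqE yE xy andbT orbC.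
by have /max_of_leP[-> _] := xy; case: eqVneq.
Qed.

End ModifiedOrder.

(** * The modified basic set *)

Section BasicSet.
Variables (Lambda I : finType) (d : Lambda -> I -> nat).
Variables (B : {set Lambda}) (le : rel Lambda).
Variable Psi : {l : Lambda | l \in B} -> I.
Hypothesis B_ubs : unitriangular_basic_set d B le Psi.
Variable p : Lambda -> Lambda.
Variable m : {l : Lambda | l \in B} -> {l : Lambda | l \in B}.
Hypotheses (pK : involutive p) (mK : involutive m).
Hypothesis d_twist : forall l b, d (p l) (Psi (m b)) = d l (Psi b).

Let le_total : total_order le. Proof. by case: B_ubs. Qed.
Let le_refl : reflexive le. Proof. by case: le_total. Qed.
Let le_anti : antisymmetric le. Proof. by case: le_total. Qed.
Let le_trans : transitive le. Proof. by case: le_total. Qed.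
Let le_tot : total le. Proof. by case: le_total. Qed.
Let d1 b : d (val b) (Psi b) = 1%N. Proof. by case: B_ubs. Qed.
Local Notation prec := (preceq le p).
Let prec_anti : antisymmetric prec.
Proof. by case: (preceq_total_order le_total pK). Qed.

Lemma decomposition_le l b : d l (Psi b) != 0%N -> le l (val b).
Proof.
by case: B_ubs => _ _ _ d0 dl; apply: contraNT dl => /(d0 _ _ _ erefl)->.
Qed.

Lemma decomposition_twist_le l b : d l (Psi b) != 0%N -> le (p l) (val (m b)).
Proof. by rewrite -d_twist; apply: decomposition_le. Qed.

Lemma decomposition_m b : d (p (val (m b))) (Psi b) = 1%N.
Proof. by rewrite -d_twist pK d1. Qed.

(** The two alternatives for [y] are the values of [Theta b]. They are spelled
    out because [Theta] is defined by a comparison in the modified order, and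
    this comparison is decided by the present lemma ([ThetaP]). *)
Lemma decomposition_preceq l b (y : Lambda) : d l (Psi b) != 0%N ->
  y = val b /\ le (val (m b)) (val b) \/
  y = p (val (m b)) /\ ~~ le (val (m b)) (val b) ->
  prec l y.
Proof.
move=> dl yE.
have lb := decomposition_le dl; have plmb := decomposition_twist_le dl.
have bm : le (p (val b)) (val (m b)).
  by apply: decomposition_twist_le; rewrite d1.
have mb : le (p (val (m b))) (val b).
  by apply: decomposition_le; rewrite decomposition_m.
case: yE => -[-> mbb].
  apply: preceq_le => //.
    by apply/max_of_leP => //; split=> //; apply: le_trans plmb mbb.
  by apply: max_of_l => //; apply: le_trans bm mbb.
have bmb : le (val b) (val (m b)).
  by have := le_tot (val b) (val (m b)); rewrite (negPf mbb) orbF.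
have My : max_of le (p (val (m b))) (p (p (val (m b)))) = val (m b).
  by rewrite pK max_ofC //; apply: max_of_l => //; apply: le_trans mb bmb.
have Ml : le (max_of le l (p l)) (val (m b)).
  by apply/max_of_leP => //; split=> //; apply: le_trans lb bmb.
rewrite preceqE // My Ml andbT; case: eqVneq => //= lE.
have [||lE'] := @max_of_orbit _ le _ pK l (p (val (m b))).
- by rewrite My.
- by move=> ->; apply: le_refl.
- by rewrite lE' pK (negPf mbb) in lb.
Qed.

Lemma ThetaP b :
  Theta le p m b = val b /\ le (val (m b)) (val b) \/
  Theta le p m b = p (val (m b)) /\ ~~ le (val (m b)) (val b).
Proof.
rewrite /Theta; have [mbb|mbb] := boolP (le (val (m b)) (val b));
  [left|right]; split=> //.
  apply: max_of_l => //; apply: (@decomposition_preceq _ b); last by left.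
  by rewrite decomposition_m.
suff : prec (val b) (p (val (m b))) by rewrite /max_of => ->.
by apply: (@decomposition_preceq _ b); [rewrite d1 | right].
Qed.

Lemma decomposition_Theta b : d (Theta le p m b) (Psi b) = 1%N.
Proof. by case: (ThetaP b) => -[-> _]; rewrite ?decomposition_m ?d1. Qed.

Lemma preceq_Theta l b : d l (Psi b) != 0%N -> prec l (Theta le p m b).
Proof. by move=> dl; apply: decomposition_preceq dl (ThetaP b). Qed.

Lemma Theta_inj : injective (Theta le p m).
Proof.
(* If [b = p (m c)] and [m b <= b], then [m c = p b <= m b <= b <= c], whereas
   [Theta c = p (m c)] requires [c < m c] when it differs from [c]. *)
have mixed b c : val b = p (val (m c)) ->
    le (val (m b)) (val b) -> le (val (m c)) (val c).
  move=> bE mbb.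
  have bc : le (val b) (val c).
    by apply: decomposition_le; rewrite bE decomposition_m.
  have := @decomposition_twist_le (val b) b; rewrite d1 bE pK => /(_ isT) mcb.
  exact: le_trans (le_trans mcb mbb) bc.
move=> b c E.
case: (ThetaP b) (ThetaP c) => -[bE mb] [] [cE mc]; rewrite bE cE in E.
- exact: val_inj.
- by rewrite (mixed _ _ E mb) in mc.
- by rewrite (mixed _ _ (esym E) mc) in mb.
- exact/(can_inj mK)/val_inj/(can_inj pK).
Qed.

Lemma unitriangular_basic_set_tilde :
  unitriangular_basic_set d (Btilde le p m) prec (Psi_tilde le Psi p m).
Proof.
have Theta_iinv (l : {l | l \in Btilde le p m}) :
    Theta le p m (iinv (Btilde_codom l)) = val l by exact: f_iinv.
split; first exact: preceq_total_order.
- have [Psi' PsiK Psi'K] : bijective Psi by case: B_ubs.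
  have Theta_in i : Theta le p m (Psi' i) \in Btilde le p m.
    by rewrite inE codom_f.
  pose in_Btilde (l : Lambda) : Prop := l \in Btilde le p m.
  exists (fun i => exist in_Btilde _ (Theta_in i)) => [l|i]; last first.
    rewrite /Psi_tilde -[RHS]Psi'K; congr Psi; apply: Theta_inj.
    by rewrite Theta_iinv.
  by apply: val_inj; rewrite /= /Psi_tilde PsiK Theta_iinv.
- move=> l.
  by rewrite -[RHS](decomposition_Theta (iinv (Btilde_codom l))) Theta_iinv.
- move=> _ l b <-; apply: contraNeq => dl.
  by have := preceq_Theta dl; rewrite Theta_iinv.
Qed.
End BasicSet.

Theorem theorem32
    (A : idomainType) (A_closed : integrally_closed A)
    (L : fieldType) (theta : {rmorphism A -> L})
    (L_frac : field_of_fractions_of_image theta)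
    (H : freeAlgType A) (H_sym : symmetric_algebra H)
    (KH_split : split_alg (frac_ext H))
    (KH_semisimple : semisimple_alg (frac_ext H))
    (LH_split : split_alg (scalar_ext theta H))
    (Lambda : finType) (V : Lambda -> fdmod (frac_ext H))
    (V_irr : irr_family V)
    (Irr_LH : finType) (S : Irr_LH -> fdmod (scalar_ext theta H))
    (S_irr : irr_family S)
    (dtheta : {additive R0 (frac_ext H) -> R0 (scalar_ext theta H)})
    (dtheta_dec : is_decomposition_map dtheta)
    (d : Lambda -> Irr_LH -> nat)
    (d_dec : are_decomposition_numbers dtheta V S d)
    (B : {set Lambda}) (le : rel Lambda)
    (Psi : {l : Lambda | l \in B} -> Irr_LH)
    (B_ubs : unitriangular_basic_set d B le Psi)
    (phi : {lrmorphism H -> H}) (phi_invol : involutive phi)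
    (lprime : Lambda -> Lambda)
    (lprime_twist : forall l : Lambda,
        isom (twist (ext_map (@FracField.tofrac A) phi) (V l)) (V (lprime l)))
    (m : {l : Lambda | l \in B} -> {l : Lambda | l \in B})
    (m_twist : forall l : {l : Lambda | l \in B},
        isom (twist (ext_map theta phi) (S (Psi l))) (S (Psi (m l)))) :
  unitriangular_basic_set d (Btilde le lprime m) (preceq le lprime)
    (Psi_tilde le Psi lprime m).
Proof.
have [_ V_inj _] := V_irr; have [_ S_inj _] := S_irr.
have [_ [Psi' PsiK Psi'K] _ _] := B_ubs.
have lprimeK : involutive lprime.
  exact: twist_index_involutive (ext_map_involutive phi_invol) V_inj
    lprime_twist.
have mK : involutive m.
  apply: twist_index_involutive (ext_map_involutive phi_invol) _ m_twist.
  by move=> b c /S_inj/(can_inj PsiK).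
pose q i := Psi (m (Psi' i)).
have q_inj : injective q.
  by move=> i j /(can_inj PsiK)/(can_inj mK)/(can_inj Psi'K).
have qP j : isom (twist (ext_map theta phi) (S j)) (S (q j)).
  by rewrite -{1}[j]Psi'K.
apply: unitriangular_basic_set_tilde => // l b.
rewrite -{1}[b]PsiK -/(q _).
exact: decomposition_numbers_twist.
Qed.
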